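(* Let $G$ be a graph of order $n$ without isolated vertices. Then $\chi_l(G)\leq 2R'(G)$, with equality if and only if $G\cong K_k\bullet K_{1,n-k}$ for some $k\in\{1,\ldots,n\}$.
   Context: Graphs are finite, simple, undirected, with nonempty vertex set; the order of a graph is its number of vertices, and $d(u)$ denotes the degree of a vertex $u$ in $G$. $R'(G)=\sum_{uv\in E(G)}\frac{1}{\max\{d(u),d(v)\}}$. Given a list $L(v)$ of colors assigned to each vertex $v$ of $G$, a list coloring is a coloring $l$ of the vertices of $G$ such that $l(v)\in L(v)$ for every vertex $v$ and $l(x)\neq l(y)$ for every $xy\in E(G)$. The graph $G$ is $k$-choosable if for every list assignment $L$ with $|L(v)|\geq k$ for all $v\in V(G)$ there exists a list coloring of $G$. The list chromatic number $\chi_l(G)$ is the minimum $k$ for which $G$ is $k$-choosable. For integers $n\geq k\geq 1$, $K_k\bullet K_{1,n-k}$ denotes the graph of order $n$ obtained by identifying the center of the star $K_{1,n-k}$ with a vertex of the complete graph $K_k$ (that is, attaching $n-k$ pendant vertices to a single vertex of $K_k$). In particular, if $k\in\{1,2\}$, $K_k\bullet K_{1,n-k}\cong K_{1,n-1}$, and if $k=n$, $K_k\bullet K_{1,n-k}\cong K_n$. *)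

(* Defs.v *)
From mathcomp Require Import all_boot all_order all_algebra.
From mathcomp Require Import boolp.

Set Implicit Arguments.
Unset Strict Implicit.
Unset Printing Implicit Defensive.

Import GRing.Theory.

(* The vertex set may be empty here: nonemptiness is left to be assumed. *)
Record sgraph := SGraph {
  vertex :> finType;
  adj : rel vertex;
  adj_sym : symmetric adj;
  adj_irrefl : irreflexive adj }.

Definition deg (G : sgraph) (v : G) : nat := #|[set u | adj v u]|.

Definition isolated (G : sgraph) (v : G) : Prop := forall u : G, ~~ adj v u.

Definition edges (G : sgraph) : {set {set G}} :=
  [set A : {set G} | [exists u, exists v, adj u v && (A == [set u; v])]].

(* For an edge A = {u, v}, the inner maximum is max (deg u) (deg v). *)
Definition Rprime (G : sgraph) : rat :=
  (\sum_(A in edges G) ((\max_(v in A) deg v)%N%:R)^-1)%R.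

Definition isomorphic (G H : sgraph) : Prop :=
  exists2 f : G -> H, bijective f & forall u v : G, adj (f u) (f v) = adj u v.

(* Finite palettes suffice: the graph is finite, and shrinking the lists to   *)
(* finite ones of size at least k only makes the condition harder to satisfy. *)
Definition list_coloring (G : sgraph) (C : finType) (L : G -> {set C})
    (l : G -> C) : Prop :=
  (forall v, l v \in L v) /\ (forall x y, adj x y -> l x != l y).

Definition choosable (G : sgraph) (k : nat) : Prop :=
  forall (C : finType) (L : G -> {set C}),
    (forall v, k <= #|L v|) -> exists l : G -> C, list_coloring L l.

Lemma choosable_order (G : sgraph) : choosable G #|G|.
Proof.
move=> C L HL.
have LN v : exists c, c \in L v.
  by apply/set0Pn; rewrite -card_gt0; apply: leq_trans (HL v); apply/card_gt0P; exists v.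
suff H (s : seq G) : uniq s ->
    exists l : G -> C, (forall v, l v \in L v) /\ {in s &, injective l}.
  have [l [lL lI]] := H (enum G) (enum_uniq _).
  exists l; split=> // x y xy; apply/eqP => /lI; rewrite !mem_enum => /(_ isT isT) exy.
  by rewrite exy adj_irrefl in xy.
elim: s => [|x s IH] Us.
  by exists (fun v => xchoose (LN v)); split=> // v; apply: xchooseP.
have [l [lL lI]] := IH (proj2 (andP Us)).
have /subsetPn[c cL cN] : ~~ (L x \subset [set l y | y in s]).
  apply/negP => /subset_leq_card; rewrite leqNgt => /negP; apply.
  apply: leq_ltn_trans (leq_imset_card _ _) _.
  apply: leq_ltn_trans (card_size s) _.
  by apply: leq_trans (HL x); have := max_card (mem (x :: s)); rewrite (card_uniqP Us).
have cl y : y \in s -> l y != c.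
  by move=> ys; apply: contraNneq cN => <-; apply: imset_f.
exists (fun v => if v == x then c else l v); split=> [v|u v].
  by case: eqP => [->|].
rewrite !inE; have [->|_] := eqVneq u x; have [->|_] := eqVneq v x => //= us vs E.
- by have := cl _ vs; rewrite E eqxx.
- by have := cl _ us; rewrite E eqxx.
- exact: lI.
Qed.

Lemma choosable_ex (G : sgraph) : exists k, `[< choosable G k >].
Proof. by exists #|G|; apply/asboolP; exact: choosable_order. Qed.

Definition chi_l (G : sgraph) : nat := ex_minn (choosable_ex G).

Section CliqueStar.
Variables k m : nat.

(* Vertices [inl i] form K_k, vertices [inr j] are the leaves of K_{1,m}, and  *)
(* the center of the star is identified with vertex 0 of K_k (so k > 0 is      *)
(* needed for this to be the intended graph).                                  *)
Definition clique_star_adj (x y : 'I_k + 'I_m) : bool :=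
  match x, y with
  | inl i, inl j => i != j
  | inl i, inr _ | inr _, inl i => i == 0 :> nat
  | inr _, inr _ => false
  end.

Lemma clique_star_sym : symmetric clique_star_adj.
Proof. by move=> [i|i] [j|j] //=; rewrite eq_sym. Qed.

Lemma clique_star_irrefl : irreflexive clique_star_adj.
Proof. by move=> [i|i] //=; rewrite eqxx. Qed.

Definition clique_star : sgraph := SGraph clique_star_sym clique_star_irrefl.

End CliqueStar.

(* Main.v *)
Require Import Defs.
From mathcomp Require Import all_boot all_order all_algebra.
From mathcomp Require Import boolp zify.
Import GRing.Theory Num.Theory.

Set Implicit Arguments.
Unset Strict Implicit.
Unset Printing Implicit Defensive.

(** Rank the vertices 0, 1, ..., n - 1 by non-increasing degree.  Charging each
    edge to its endpoint of smaller rank, whose degree is the larger one, gives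
    [R'(G) = sum_u e(u) / d(u)], where [e(u)] counts the neighbours of [u] of
    larger rank ([Rprime_ranking]).

    Put [chi_l(G) = D + 1].  Colouring greedily in the order of the ranking, a
    vertex [u] has at most [min (rank u) (d u)] forbidden colours; since [D]
    colours do not suffice, some vertex has both rank and degree at least [D]
    ([high_rank_high_degree]), and so the vertices of rank 0, ..., D all have
    degree at least [D].  A vertex of rank [i <= D] has at most [i] neighbours
    before it, hence [e(u) / d(u) >= 1 - i / d(u) >= 1 - i / D].  Summing over
    [i = 0, ..., D] gives [R'(G) >= (D + 1) / 2], with equality exactly when
    each of these estimates is sharp and [e] vanishes beyond rank [D]
    ([Rprime_lower_bound]).

    Sharpness is rigid ([equality_iso]): each vertex of rank at most [D] is
    joined to all earlier ones, so these vertices form a clique; those of rank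
    1, ..., D have degree exactly [D], hence no neighbour outside the clique;
    the vertices beyond are independent, so, not being isolated, they hang on
    the vertex of rank 0.  Conversely, on a clique with pendant vertices all
    the estimates are sharp ([clique_star_index]), and the clique, or an edge
    if the clique is a single vertex, bounds [chi_l] from below. *)

(** * Neighbours and degree rankings *)

Lemma exists_neighbour (G : sgraph) (u : G) : ~ isolated u -> exists v, adj u v.
Proof.
case: (pickP (adj u)) => [v uv _ | none []]; first by exists v.
by move=> v; rewrite none.
Qed.

Lemma deg_gt0 (G : sgraph) (u : G) : ~ isolated u -> 0 < deg u.
Proof.
by move=> /exists_neighbour[v uv]; apply/card_gt0P; exists v; rewrite inE.
Qed.

(** Ties between equal degrees are broken by the ranking, so every edge has a
    unique endpoint of smaller rank, and that endpoint attains the maximum of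
    the two degrees. *)
Definition degree_ranking (G : sgraph) (r : G -> nat) : Prop :=
  [/\ injective r, forall u, r u < #|G|
    & forall u v, r u < r v -> deg v <= deg u].

Definition later_deg (G : sgraph) (r : G -> nat) (u : G) : nat :=
  #|[set v | adj u v & r u < r v]|.

Lemma degree_ranking_exists (G : sgraph) :
  exists r : G -> nat, degree_ranking r.
Proof.
pose ge_deg (u v : G) := deg v <= deg u.
pose s := sort ge_deg (enum G).
have sP u : u \in s by rewrite mem_sort mem_enum.
have ge_deg_tr : transitive ge_deg.
  by move=> y x z yx zy; apply: leq_trans yx.
have s_sorted : sorted ge_deg s.
  by apply: sort_sorted => u v; apply: leq_total.
exists (index^~ s); split=> [u v E | u | u v uv].
- by rewrite -(nth_index u (sP u)) E nth_index.
- by rewrite cardE -(size_sort ge_deg) index_mem.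
- exact: (sorted_ltn_index ge_deg_tr s_sorted).
Qed.

Lemma card_rank_lt (G : sgraph) (r : G -> nat) (m : nat) :
  injective r -> #|[set u | r u < m]| <= m.
Proof.
move=> r_inj; rewrite cardE -(size_map r) -[leqRHS](size_iota 0).
apply: uniq_leq_size; first by rewrite map_inj_uniq ?enum_uniq.
by move=> _ /mapP[u + ->]; rewrite mem_enum inE mem_iota.
Qed.

Lemma card_earlier (G : sgraph) (r : G -> nat) (u : G) :
  injective r -> #|[set v | adj u v & r v < r u]| <= r u.
Proof.
move=> r_inj; apply: leq_trans (card_rank_lt (r u) r_inj).
by apply: subset_leq_card; apply/subsetP=> v; rewrite !inE => /andP[].
Qed.

Lemma sum_rank (G : sgraph) (r : G -> nat) (F : nat -> nat) :
  injective r -> (forall u, r u < #|G|) ->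
  \sum_(u : G) F (r u) = \sum_(i < #|G|) F i.
Proof.
move=> r_inj r_lt; pose h u := Ordinal (r_lt u).
have h_inj : injective h by move=> u v /(congr1 val) /r_inj.
have h_bij : bijective h by apply: inj_card_bij; rewrite ?card_ord.
by rewrite (reindex h) //; apply: onW_bij.
Qed.

Lemma card_rank_ltE (G : sgraph) (r : G -> nat) (m : nat) :
  injective r -> (forall u, r u < #|G|) -> m <= #|G| ->
  #|[set u | r u < m]| = m.
Proof.
move=> r_inj r_lt m_le.
rewrite -sum1dep_card big_mkcond /=.
rewrite (@sum_rank G r (fun i => if i < m then 1 else 0)) // -big_mkcond.
by rewrite -(big_ord_widen #|G| (fun=> 1)) // sum1_card card_ord.
Qed.

Lemma deg_later_earlier (G : sgraph) (r : G -> nat) (u : G) :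
  injective r ->
  deg u = later_deg r u + #|[set v | adj u v & r v < r u]|.
Proof.
move=> r_inj; rewrite /deg /later_deg -cardsUI.
rewrite [X in _ = _ + X](_ : _ = 0); last first.
  by apply/eqP; rewrite cards_eq0; apply/eqP/setP=> v; rewrite !inE; lia.
rewrite addn0; apply: eq_card => v; rewrite !inE -andb_orr.
case uv: (adj u v) => //=; case: ltngtP => // /r_inj E.
by rewrite E adj_irrefl in uv.
Qed.

(** * Greedy list colouring *)

(** Colour in increasing rank: a vertex meets fewer than [k] colours already
    used on its neighbours, so its list still has a free one. *)
Lemma greedy_choosable (G : sgraph) (r : G -> nat) (k : nat) :
  injective r ->
  (forall u, #|[set v | adj u v & r v < r u]| < k) -> choosable G k.
Proof.
move=> r_inj few C L HL.
have L_gt0 v : exists c, c \in L v.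
  apply/set0Pn; rewrite -card_gt0; apply: leq_trans (HL v).
  exact: leq_ltn_trans (few v).
(* The colouring is total from the start but need only be proper on the ranks *)
(* below m, so that at most one vertex is recoloured from m to m + 1. *)
have partial m : exists l : G -> C, (forall v, l v \in L v) /\
    (forall u v, adj u v -> r u < m -> r v < m -> l u != l v).
  elim: m => [|m [l [lL lP]]].
    exists (fun v => xchoose (L_gt0 v)); split=> // v; exact: xchooseP.
  case: (pickP (fun x => r x == m)) => [x /eqP xm | no_x]; last first.
    exists l; split=> // u v uv um vm.
    by apply: lP => //; [move: (no_x u) um | move: (no_x v) vm] => /=; lia.
  have /subsetPn[c cL cN] :
      ~~ (L x \subset l @: [set v | adj x v & r v < r x]).
    apply/negP => /subset_leq_card; rewrite leqNgt => /negP; apply.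
    apply: leq_ltn_trans (leq_imset_card _ _) _.
    exact: leq_trans (few x) (HL x).
  have fresh v : adj x v -> r v < m -> c != l v.
    move=> xv vm; apply: contraNneq cN => ->.
    by apply: imset_f; rewrite inE xv xm.
  exists (fun v => if v == x then c else l v); split=> [v|u v uv um vm].
    by case: eqP => [->|].
  have below w : w != x -> r w < m.+1 -> r w < m.
    move=> wx wm; have : r w != r x by apply: contraNneq wx => /r_inj ->.
    lia.
  have [ux|ux] := eqVneq u x; have [vx|vx] := eqVneq v x.
  - by rewrite ux vx adj_irrefl in uv.
  - by apply: fresh; [rewrite -ux | apply: below].
  - by rewrite eq_sym; apply: fresh; [rewrite -vx adj_sym | apply: below].
  - by apply: lP => //; apply: below.
have [l [lL lP]] := partial (\max_u r u).+1.
exists l; split=> // x y xy.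
by apply: lP => //; rewrite ltnS; apply: (leq_bigmax (F := r)).
Qed.

Lemma chi_l_choosable (G : sgraph) : choosable G (chi_l G).
Proof. by rewrite /chi_l; case: ex_minnP => k /asboolP. Qed.

Lemma chi_l_min (G : sgraph) (k : nat) : choosable G k -> chi_l G <= k.
Proof.
by rewrite /chi_l; case: ex_minnP => m _ mP kP; apply: mP; apply/asboolP.
Qed.

(** With the same list everywhere, a list colouring is injective on a clique. *)
Lemma clique_le_chi_l (G : sgraph) (k : nat) (h : 'I_k -> G) :
  (forall i j, i != j -> adj (h i) (h j)) -> k <= chi_l G.
Proof.
move=> hP.
have [|l [_ lP]] := @chi_l_choosable G 'I_(chi_l G) (fun=> setT).
  by move=> v; rewrite cardsT card_ord.
have /leq_card : injective (l \o h).
  move=> i j /= E; apply/eqP; apply/negPn/negP => /hP /lP.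
  by rewrite E eqxx.
by rewrite !card_ord.
Qed.

(** The Welsh-Powell bound: otherwise every vertex would have fewer than [k]
    earlier neighbours, and the greedy colouring would succeed with [k] colours
    per list. *)
Lemma high_rank_high_degree (G : sgraph) (r : G -> nat) (k : nat) :
  injective r -> k < chi_l G -> exists u : G, k <= r u /\ k <= deg u.
Proof.
move=> r_inj k_lt.
have [u uP|none] := pickP (fun u : G => (k <= r u) && (k <= deg u)).
  by exists u; apply/andP.
suff /chi_l_min : choosable G k by rewrite leqNgt k_lt.
apply: (greedy_choosable r_inj) => u.
have := none u; have := deg_later_earlier u r_inj.
have := card_earlier u r_inj.
rewrite /=; lia.
Qed.

(** * The index as a sum over vertices *)

Lemma max_pair (T : finType) (F : T -> nat) (u v : T) :
  u != v -> \max_(w in [set u; v]) F w = maxn (F u) (F v).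
Proof. by move=> uv; rewrite big_setU1 ?inE //= big_set1. Qed.

(** Orienting every edge towards its endpoint of larger rank turns the sum over
    unordered pairs into a sum over the tails, each arc out of [u] having weight
    [1 / deg u]. *)
Lemma Rprime_ranking (G : sgraph) (r : G -> nat) :
  degree_ranking r ->
  Rprime G = (\sum_(u : G) (later_deg r u)%:R / (deg u)%:R)%R.
Proof.
move=> [r_inj _ r_deg].
pose P := [set p : G * G | adj p.1 p.2 & r p.1 < r p.2].
pose ends (p : G * G) := [set p.1; p.2].
have edgesE : edges G = ends @: P.
  apply/setP=> A; rewrite inE; apply/existsP/imsetP.
    move=> [u /existsP[v /andP[uv /eqP ->]]].
    case: (ltngtP (r u) (r v)) => [lt|gt|/r_inj E].
    - by exists (u, v); rewrite // inE uv.
    - by exists (v, u); [rewrite inE /= adj_sym uv | apply: setUC].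
    - by rewrite E adj_irrefl in uv.
  move=> [[u v]]; rewrite inE /= => /andP[uv _] ->.
  by exists u; apply/existsP; exists v; rewrite uv /= eqxx.
have ends_inj : {in P &, injective ends}.
  move=> [u v] [x y]; rewrite !inE /= => /andP[_ uv] /andP[_ xy] E.
  have := set21 u v; have := set22 u v.
  rewrite -/(ends (u, v)) E !inE /=.
  move=> /orP[]/eqP ? /orP[]/eqP ?; subst => //; lia.
rewrite /Rprime edgesE big_imset //=.
have -> : (\sum_(p in P) ((\max_(v in ends p) deg v)%N%:R)^-1 =
           \sum_(p in P) ((deg p.1)%:R)^-1 :> rat)%R.
  apply: eq_bigr => [[u v]]; rewrite inE /= => /andP[uv lt].
  rewrite /ends /= max_pair; last by apply: contraTneq lt => ->; rewrite ltnn.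
  by rewrite (maxn_idPl (r_deg _ _ lt)).
rewrite (eq_bigl (fun p : G * G => true && (adj p.1 p.2 && (r p.1 < r p.2))));
  last by move=> p; rewrite inE.
rewrite -(pair_big_dep xpredT (fun u v => adj u v && (r u < r v))
           (fun u _ => ((deg u)%:R)^-1 : rat)%R) /=.
apply: eq_bigr => u _; rewrite sumr_const mulr_natl.
by congr (_ *+ _)%R; apply: eq_card => v; rewrite !inE.
Qed.

(** * The lower bound and its equality condition *)

(** This is [e(u) / d(u) >= 1 - i / D] for a vertex of rank [i <= D], cleared of
    denominators.  Truncated subtraction makes the left side vanish beyond rank
    [D], so that one formula covers all vertices. *)
Lemma later_deg_bound (G : sgraph) (r : G -> nat) (D : nat) (u : G) :
  injective r -> (r u <= D -> D <= deg u) ->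
  (D - r u) * deg u <= later_deg r u * D.
Proof.
move=> r_inj; have := deg_later_earlier u r_inj.
have := card_earlier u r_inj.
case: (leqP (r u) D) => [le|gt]; last by rewrite (_ : D - r u = 0); lia.
by move=> ? ? /(_ isT); nia.
Qed.

Lemma sum_tent (D n : nat) : D < n -> (\sum_(i < n) (D - i)) * 2 = D * D.+1.
Proof.
move=> Dn; rewrite -(big_mkord xpredT (fun i => D - i)).
rewrite (big_cat_nat (n := D.+1)) //= [X in _ + X]big_nat_cond.
rewrite [X in _ + X]big1 ?addn0; last by move=> i; lia.
elim: D {Dn} => [|D IH]; first by rewrite big_nat1.
rewrite big_nat_recl // subn0 mulnDl.
rewrite (eq_bigr (fun i => D - i)); last by move=> i _; lia.
by rewrite IH; lia.
Qed.

(** Summing the previous bound over all vertices: the ranks run through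
    0, ..., n - 1, so the lower bounds add up to [(D + 1) / 2], and the sum is
    sharp exactly when every term is. *)
Lemma Rprime_lower_bound (G : sgraph) (r : G -> nat) (D : nat) :
  degree_ranking r -> 0 < D < #|G| -> (forall u : G, 0 < deg u) ->
  (forall u, r u <= D -> D <= deg u) ->
  (D.+1%:R <= 2 * Rprime G
     ?= iff [forall u, (D - r u) * deg u == later_deg r u * D]%N)%R.
Proof.
move=> rP /andP[D_gt0 D_lt] deg_gt0 top_deg.
have [r_inj r_lt _] := rP.
have D0 : (D%:R != 0 :> rat)%R by rewrite pnatr_eq0; lia.
have -> : (D.+1%:R = 2 * \sum_(u : G) ((D - r u)%N%:R / D%:R) :> rat)%R.
  rewrite -mulr_suml -natr_sum.
  rewrite (@sum_rank G r (fun i => D - i)) // mulrA -natrM mulnC sum_tent //.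
  by rewrite natrM mulrAC mulfV // mul1r.
rewrite (Rprime_ranking rP).
have termwise u : ((D - r u)%N%:R / D%:R <= (later_deg r u)%:R / (deg u)%:R
    ?= iff ((D - r u) * deg u == later_deg r u * D)%N :> rat)%R.
  have d0 : ((deg u)%:R != 0 :> rat)%R by rewrite pnatr_eq0 -lt0n.
  split; last by rewrite eqr_div // -!natrM eqr_nat.
  rewrite ler_pdivlMr ?ltr0n // mulrAC ler_pdivrMr ?ltr0n //.
  by rewrite -!natrM ler_nat later_deg_bound // => /top_deg.
have /(leif_sum (P := xpredT)) [le eq] := fun u (_ : true) => termwise u.
split; first by rewrite ler_pM2l.
by rewrite (inj_eq (mulfI _)) // eq.
Qed.

(** The hypothesis [tight] is sharpness of the bound at every vertex.  The ranks
    0, ..., D become the clique, with rank 0 as its center, and the other ranks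
    the leaves. *)
Lemma equality_iso (G : sgraph) (r : G -> nat) (D : nat) :
  degree_ranking r -> 0 < D < #|G| -> (forall v : G, ~ isolated v) ->
  (forall u, r u <= D -> D <= deg u) ->
  (forall u, (D - r u) * deg u = later_deg r u * D) ->
  isomorphic G (clique_star D.+1 (#|G| - D.+1)).
Proof.
move=> [r_inj r_lt r_deg] /andP[D_gt0 D_lt] hiso top_deg tight.
have adj_top u w : r w < r u -> r u <= D -> adj u w.
  move=> wu uD.
  (* Sharpness forces u to have r u earlier neighbours, that is, all of the *)
  (* r u vertices of smaller rank. *)
  have early_sub : [set v | adj u v & r v < r u] \subset [set v | r v < r u].
    by apply/subsetP=> v; rewrite !inE => /andP[].
  have : [set v | adj u v & r v < r u] == [set v | r v < r u].
    rewrite eqEcard early_sub card_rank_ltE //; last exact: ltnW.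
    have := deg_later_earlier u r_inj.
    have := top_deg u uD; have := tight u; nia.
  by move=> /eqP/setP/(_ w); rewrite !inE wu andbT.
have low_indep u v : D < r u -> r u < r v -> ~~ adj u v.
  move=> Du uv; apply/negP => a.
  have : 0 < later_deg r u by apply/card_gt0P; exists v; rewrite inE a.
  by have := tight u; nia.
have top_closed u v : 0 < r u <= D -> D < r v -> ~~ adj u v.
  move=> /andP[u_gt0 uD] Dv; apply/negP => a.
  have degu : deg u = D.
    have := deg_later_earlier u r_inj.
    have := card_earlier u r_inj.
    have := top_deg u uD; have := tight u; nia.
  (* The rest of the clique already exhausts the D neighbours of u. *)
  have : v |: ([set x | r x < D.+1] :\ u) \subset [set x | adj u x].
    apply/subsetP=> x; rewrite !inE => /orP[/eqP -> //|/andP[xu xD]].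
    case: (ltngtP (r x) (r u)) => [lt|gt|/r_inj E]; last by rewrite E eqxx in xu.
      exact: adj_top.
    by rewrite adj_sym; apply: adj_top.
  move/subset_leq_card; rewrite -/(deg u) degu cardsU1 !inE.
  have := cardsD1 u [set x | r x < D.+1].
  by rewrite card_rank_ltE // !inE; lia.
have low_center u v : r u = 0 -> D < r v -> adj u v.
  move=> u0 Dv.
  have [w vw] := exists_neighbour (hiso v).
  suff /r_inj <- : r w = r u by rewrite adj_sym.
  have := low_indep v w Dv; have := low_indep w v; have := top_closed w v.
  rewrite (adj_sym w) vw.
  case: (ltngtP (r v) (r w)) => [||/r_inj E]; try lia.
  by rewrite E adj_irrefl in vw.
have cardE : #|G| = D.+1 + (#|G| - D.+1) by rewrite subnKC.
pose f u : clique_star D.+1 (#|G| - D.+1) :=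
  split (cast_ord cardE (Ordinal (r_lt u))).
have f_inj : injective f.
  by move=> u v /(can_inj splitK) /cast_ord_inj /(congr1 val) /r_inj.
have f_bij : bijective f.
  by apply: inj_card_bij => //; rewrite card_sum !card_ord -cardE.
exists f => // u v; wlog uv : u v / r u < r v.
  move=> H; case: (ltngtP (r u) (r v)) => [lt|gt|/r_inj ->].
  - exact: H.
  - by rewrite adj_sym (adj_sym u); apply: H.
  - by rewrite !adj_irrefl.
rewrite /f; case: splitP => i /= ui; case: splitP => j /= vj.
- rewrite adj_sym adj_top //; last by rewrite vj -ltnS.
  by apply/eqP => E; move: uv; rewrite ui vj E ltnn.
- have i_lt := ltn_ord i.
  case: eqP => i0; first by rewrite low_center //; lia.
  by apply/esym/negbTE/top_closed; lia.
- by have := ltn_ord j; lia.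
- by apply/esym/negbTE/low_indep; lia.
Qed.

(** * Cliques with pendant vertices at one vertex *)

(** With the center first and the leaves last, degrees do not increase, also for
    [k = 1], where the center is the whole clique. *)
Definition clique_star_rank (k m : nat) (x : clique_star k m) : nat :=
  match x with inl i => i | inr j => k + j end.

Lemma clique_star_rank_inj (k m : nat) : injective (@clique_star_rank k m).
Proof.
move=> [i|i] [j|j] /= E.
- by congr inl; apply: val_inj.
- by have := ltn_ord i; lia.
- by have := ltn_ord j; lia.
- by congr inr; apply: val_inj; move/addnI: E.
Qed.

Lemma clique_star_deg_center (k m : nat) (i : 'I_k) :
  i = 0 :> nat -> deg (inl i : clique_star k m) = (k + m).-1.
Proof.
move=> i0; rewrite /deg (_ : [set u | _] = [set~ inl i]).
  by rewrite cardsC1 card_sum !card_ord.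
by apply/setP=> [[j|j]]; rewrite !inE /= eq_sym // i0.
Qed.

Lemma clique_star_deg_clique (k m : nat) (i : 'I_k) :
  0 < i -> deg (inl i : clique_star k m) = k.-1.
Proof.
move=> i0; rewrite /deg (_ : [set u | _] = inl @: [set~ i]).
  by rewrite card_imset ?cardsC1 ?card_ord //; apply: inl_inj.
apply/setP=> [[j|j]]; rewrite !inE /=.
  by rewrite mem_imset ?inE 1?eq_sym //; apply: inl_inj.
by rewrite eqn0Ngt i0; apply/esym/imsetP => [[]].
Qed.

Lemma clique_star_deg_leaf (k m : nat) (j : 'I_m) :
  0 < k -> deg (inr j : clique_star k m) = 1.
Proof.
case: k => // k _; rewrite /deg (_ : [set u | _] = [set inl ord0]) ?cards1 //.
by apply/setP=> [[i|i]]; rewrite !inE.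
Qed.

Lemma clique_star_ranking (k m : nat) :
  0 < k -> degree_ranking (@clique_star_rank k m).
Proof.
move=> k_gt0; split; first exact: clique_star_rank_inj.
  move=> [i|j]; rewrite card_sum !card_ord /= ?ltn_add2l //.
  by apply: leq_trans (ltn_ord i) _; apply: leq_addr.
move=> [i|i] [j|j] /=; rewrite ?clique_star_deg_leaf //.
- move=> ij; rewrite (@clique_star_deg_clique k m j) ?(leq_ltn_trans _ ij) //.
  have [i0|i_gt0] := posnP i; first by rewrite clique_star_deg_center //; lia.
  by rewrite clique_star_deg_clique.
- move=> _; have i_lt := ltn_ord i; have j_lt := ltn_ord j.
  have [i0|i_gt0] := posnP i; first by rewrite clique_star_deg_center //; lia.
  by rewrite clique_star_deg_clique //; lia.
- by have := ltn_ord j; lia.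
Qed.

Lemma clique_star_later_deg_leaf (k m : nat) (j : 'I_m) :
  later_deg (@clique_star_rank k m) (inr j) = 0.
Proof.
apply: eq_card0 => [[i|i]]; rewrite !inE //=.
by have := ltn_ord i; lia.
Qed.

Lemma clique_star_later_deg_center (k m : nat) (i : 'I_k) :
  i = 0 :> nat -> later_deg (@clique_star_rank k m) (inl i) = (k + m).-1.
Proof.
move=> i0; rewrite -(clique_star_deg_center m i0).
rewrite (deg_later_earlier _ (@clique_star_rank_inj k m)) /= i0.
by rewrite [X in _ = _ + X]eq_card0 ?addn0 // => x; rewrite !inE ltn0 andbF.
Qed.

Lemma clique_star_later_deg_clique (k m : nat) (i : 'I_k) :
  0 < i -> later_deg (@clique_star_rank k m) (inl i) = k.-1 - i.
Proof.
move=> i_gt0; have i_lt := ltn_ord i.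
have [r_inj r_lt _] := @clique_star_ranking k m (leq_ltn_trans (leq0n i) i_lt).
(* A non-center clique vertex is joined to every vertex of smaller rank. *)
have earlierE : [set v | adj (inl i : clique_star k m) v
                       & clique_star_rank v < i] =
                [set v : clique_star k m | clique_star_rank v < i].
  apply/setP=> [[j|j]]; rewrite !inE /= ?eqn0Ngt ?i_gt0 /=.
    by rewrite -val_eqE /=; lia.
  by lia.
have := deg_later_earlier (inl i : clique_star k m) r_inj.
rewrite clique_star_deg_clique // earlierE card_rank_ltE //.
  by move=> ->; rewrite addnK.
by rewrite card_sum !card_ord; lia.
Qed.

Lemma card_set_iso (G H : sgraph) (f : G -> H) (P : pred H) :
  bijective f -> #|[set v | P (f v)]| = #|[set x | P x]|.
Proof.
move=> f_bij; rewrite -(card_imset _ (bij_inj f_bij)).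
apply: eq_card => x; rewrite inE; have [g fK gK] := f_bij.
by rewrite -[x in LHS]gK mem_imset ?inE ?gK //; apply: bij_inj.
Qed.

(** All estimates of [Rprime_lower_bound] are sharp here with
    [D = maxn k 2 - 1]; the maximum accounts for [k = 1], where the graph is a
    star and the center with any leaf forms the maximal clique. *)
Lemma clique_star_index (G : sgraph) (k m : nat) :
  0 < k -> 1 < #|G| -> (forall v : G, ~ isolated v) ->
  isomorphic G (clique_star k m) ->
  (2 * Rprime G = (maxn k 2)%:R)%R.
Proof.
move=> k_gt0 G_gt1 hiso [f f_bij f_adj].
have degE u : deg u = deg (f u).
  rewrite /deg -(card_set_iso _ f_bij).
  by apply: eq_card => v; rewrite !inE f_adj.
pose r u := clique_star_rank (f u).
have laterE u : later_deg r u = later_deg (@clique_star_rank k m) (f u).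
  rewrite /later_deg -(card_set_iso _ f_bij).
  by apply: eq_card => v; rewrite !inE f_adj.
have cardE : #|G| = k + m by rewrite (bij_eq_card f_bij) card_sum !card_ord.
have [s_inj s_lt s_deg] := clique_star_ranking m k_gt0.
have rP : degree_ranking r.
  split; first by move=> u v /s_inj /(bij_inj f_bij).
    by move=> u; rewrite (bij_eq_card f_bij); apply: s_lt.
  by move=> u v; rewrite !degE; apply: s_deg.
have deg_gt0 (u : G) : 0 < deg u := deg_gt0 (hiso u).
have D_bounds : 0 < (maxn k 2).-1 < #|G| by lia.
have top_deg u : r u <= (maxn k 2).-1 -> (maxn k 2).-1 <= deg u.
  rewrite degE /r; case: (f u) => [i|j] /=; last first.
    by rewrite clique_star_deg_leaf //; lia.
  have := ltn_ord i; have [i0|i_gt0] := posnP i.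
    by rewrite clique_star_deg_center //; lia.
  by rewrite clique_star_deg_clique //; lia.
have [_ eqP'] := Rprime_lower_bound rP D_bounds deg_gt0 top_deg.
rewrite -(prednK (_ : 0 < maxn k 2)); last by lia.
apply/esym/eqP; rewrite eqP'; apply/forallP=> u; apply/eqP.
rewrite laterE degE /r; case: (f u) => [i|j] /=; last first.
  by rewrite clique_star_later_deg_leaf clique_star_deg_leaf //; lia.
have := ltn_ord i; have [i0|i_gt0] := posnP i.
  rewrite clique_star_later_deg_center // clique_star_deg_center // i0.
  by rewrite subn0 mulnC.
rewrite clique_star_later_deg_clique // clique_star_deg_clique // => i_lt.
by rewrite (maxn_idPl (_ : 1 < k)) //; lia.
Qed.

(** * The theorem *)

Lemma two_le_chi_l (G : sgraph) (u v : G) : adj u v -> 1 < chi_l G.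
Proof.
move=> uv; apply: (@clique_le_chi_l G 2 (fun i => if i == ord0 then u else v)).
by case=> [[|[|]] // ?] [[|[|]] // ?] _ //=; rewrite adj_sym.
Qed.

Theorem corollary1p6 (n : nat) (G : sgraph) (hn : 0 < n) (hG : #|G| = n)
    (hiso : forall v : G, ~ isolated v) :
  ((chi_l G)%:R <= 2 * Rprime G)%R /\
  (((chi_l G)%:R = 2 * Rprime G)%R <->
   exists k : nat, 1 <= k <= n /\ isomorphic G (clique_star k (n - k))).
Proof.
subst n; have /card_gt0P[x _] := hn.
have chi_gt1 : 1 < chi_l G.
  by have [y /two_le_chi_l] := exists_neighbour (hiso x).
have deg_gt0 (u : G) : 0 < deg u := deg_gt0 (hiso u).
have [r rP] := degree_ranking_exists G.
have [r_inj r_lt r_deg] := rP.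
have [D chiE] : exists D, chi_l G = D.+1.
  by exists (chi_l G).-1; rewrite prednK // ltnW.
have [u [Du degu]] : exists u : G, D <= r u /\ D <= deg u.
  by apply: high_rank_high_degree => //; rewrite chiE.
have D_bounds : 0 < D < #|G|.
  by rewrite (leq_ltn_trans Du) // andbT -ltnS -chiE.
have top_deg v : r v <= D -> D <= deg v.
  move=> vD; apply: leq_trans degu _.
  have := leq_trans vD Du; rewrite leq_eqVlt => /orP[/eqP/r_inj -> //|].
  exact: r_deg.
have [le eq] := Rprime_lower_bound rP D_bounds deg_gt0 top_deg.
rewrite chiE; split=> //; split=> [/eqP|[k [/andP[k_gt0 _] iso]]].
  rewrite eq => /forallP tight; exists D.+1; split; first by case/andP: D_bounds.
  by apply: (equality_iso rP D_bounds hiso top_deg) => v; apply/eqP.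
apply/eqP; rewrite Order.POrderTheory.eq_le le -chiE (@clique_star_index G k (#|G| - k)) //.
  rewrite ler_nat geq_max chi_gt1 andbT.
  have [f [g fK gK] f_adj] := iso.
  apply: (@clique_le_chi_l G k (g \o inl)) => i j ij.
  by rewrite -f_adj /= !gK.
by case/andP: D_bounds => D_gt0; apply: leq_ltn_trans.
Qed.
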